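(* Let $(G,\rho)$ be a stationary random graph of annealed polynomial growth. Then for every $\varepsilon>0$ there is a constant $C>0$ and an infinite strictly increasing (deterministic) sequence of times $\{t_n\}_{n\ge 1}$ of positive integers such that for every $n\ge 1$, $$\Pr\left(\mathbb{E}\left[d_G(X_0,X_{t_n})^2\mid (G,\rho)\right]\le C t_n\right)\ge 1-\varepsilon .$$
   Context: A random rooted graph $(G,\rho)$ is a random variable with values in the (isomorphism classes of) rooted graphs; $G$ is assumed locally finite and almost surely connected. $V_G$ is the vertex set, $d_G$ the graph metric, and $B^G_x(r)=\{y\in V_G: d_G(x,y)\le r\}$. Conditioned on $(G,\rho)$, $\{X_n\}_{n\ge 0}$ is the simple random walk on $G$ with $X_0=\rho$; $\mathbb{E}[\cdot\mid(G,\rho)]$ averages over the walk only, and the outer probability is over $(G,\rho)$. $(G,\rho)$ is stationary if $(G,X_0)$ and $(G,X_1)$ have the same law. $(G,\rho)$ has annealed polynomial growth if there are constants $c,d>0$ such that $\mathbb{E}[|B^G_\rho(r)|]\le c r^d$ for all $r\ge 1$. *)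

(* Defs.v *)
From HB Require Import structures.
From mathcomp Require Export all_boot all_order all_algebra finmap.
From mathcomp Require Export all_classical all_reals all_analysis.

Set Implicit Arguments.
Unset Strict Implicit.
Unset Printing Implicit Defensive.

Import Order.TTheory GRing.Theory Num.Theory.

#[global] Open Scope classical_set_scope.
#[global] Open Scope ring_scope.

(* Simple, undirected, locally finite graphs.  A connected locally finite graph
   is countable, so taking the vertices among the natural numbers costs no
   generality: graphs are only considered up to isomorphism (see
   [local_events]).  Connectedness is not built in: it will only be required
   almost surely. *)
Record graph := Graph {
  is_vertex : pred nat;
  nbrs : {x | is_vertex x} -> {fset {x | is_vertex x}};
  nbrs_sym : forall x y, (y \in nbrs x) = (x \in nbrs y);
  nbrs_irr : forall x, x \notin nbrs x }.

Definition vertex (G : graph) : countType := {x | is_vertex G x}.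
Coercion vertex : graph >-> countType.

Definition adj (G : graph) : rel G := fun x y => y \in nbrs x.
Arguments adj : clear implicits.

Definition path_length (G : graph) (x y : G) (n : nat) : Prop :=
  exists p : seq G, [/\ path (adj G) x p, last x p = y & size p = n].

Definition connected_graph (G : graph) : Prop :=
  forall x y : G, exists n, path_length x y n.

(* Infinite between different connected components. *)
Definition gdist (R : realType) (G : graph) (x y : G) : \bar R :=
  ereal_inf [set n%:R%:E | n in [set n | path_length x y n]].

(* The ball is stated without reference to [R]; see [gballE]. *)
Definition gball (G : graph) (x : G) (r : nat) : set G :=
  [set y | exists2 n, (n <= r)%N & path_length x y n].

Lemma gballE (R : realType) (G : graph) (x : G) (r : nat) :
  gball x r = [set y | (gdist R x y <= r%:R%:E)%E].
Proof.
apply/seteqP; split => y /=.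
  move=> [n nr xyn]; apply: (@le_trans _ _ n%:R%:E).
    by apply: ereal_inf_lbound; exists n.
  by rewrite lee_fin ler_nat.
move=> dr; apply: contrapT => yNball.
have : (r.+1%:R%:E <= gdist R x y)%E.
  apply: le_ereal_inf_tmp => _ [n xyn <-]; rewrite lee_fin ler_nat ltnNge.
  by apply/negP => nr; apply: yNball; exists n.
by move=> /le_trans /(_ dr); rewrite lee_fin ler_nat ltnn.
Qed.

Record rgraph := RGraph { rgraph_graph :> graph; root : rgraph_graph }.
Arguments root : clear implicits.

Definition rgraph_iso (G H : rgraph) : Prop :=
  exists f : G -> H, [/\ bijective f, f (root G) = root H &
    forall x y, adj H (f x) (f y) = adj G x y].

Definition rball_iso (r : nat) (G H : rgraph) : Prop :=
  exists f : G -> H, [/\ f (root G) = root H,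
    set_bij (gball (root G) r) (gball (root H) r) f &
    {in gball (root G) r &, forall x y, adj H (f x) (f y) = adj G x y}].

(* The open balls of the local (Benjamini-Schramm) topology. *)
Definition local_events : set (set rgraph) :=
  [set A | exists (r : nat) (H : rgraph), A = [set G | rball_iso r G H]].

Definition graph1 : graph :=
  @Graph (pred1 0%N) (fun=> fset0) (fun _ _ => erefl) (fun _ => isT).

HB.instance Definition _ := gen_eqMixin rgraph.
HB.instance Definition _ := gen_choiceMixin rgraph.
HB.instance Definition _ := isPointed.Build rgraph (@RGraph graph1 (exist _ 0%N isT)).

(* Measurable sets of rooted graphs are invariant under isomorphism (see
   [rgraph_iso_measurable]).  Hence measurable maps into [rgraph] and laws on
   [rgraph] are the same as measurable maps into, and laws on, the isomorphism
   classes of rooted graphs with the sigma-algebra of the local topology. *)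
HB.instance Definition _ :=
  Measurable.copy rgraph (g_sigma_algebraType local_events).

Lemma rball_iso_rgraph_iso (r : nat) (G H K : rgraph) :
  rgraph_iso G H -> rball_iso r G K -> rball_iso r H K.
Proof.
move=> [f [[g fK gK] froot fadj]] [k [kroot [kfun kinj ksurj] kadj]].
have groot : g (root H) = root G by rewrite -froot fK.
have gadj x y : adj G (g x) (g y) = adj H x y by rewrite -fadj !gK.
have fball x : gball (root G) r x -> gball (root H) r (f x).
  move=> [n nr [p [px lx sp]]]; exists n => //; exists (map f p).
  rewrite -froot path_map last_map size_map lx; split=> //.
  by rewrite (eq_path (e' := adj G)).
have gball' x : gball (root H) r x -> gball (root G) r (g x).
  move=> [n nr [p [px lx sp]]]; exists n => //; exists (map g p).
  rewrite -groot path_map last_map size_map lx; split=> //.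
  by rewrite (eq_path (e' := adj H)).
exists (k \o g); split=> /=; first by rewrite groot.
  split.
  - by move=> x /gball'; exact: kfun.
  - move=> x y /set_mem Bx /set_mem By /= kxy; apply: (can_inj gK).
    by apply: kinj kxy; apply/mem_set; exact: gball'.
  - move=> z /ksurj [x Bx <-]; exists (f x); first exact: fball.
    by rewrite /= fK.
move=> x y /set_mem Bx /set_mem By; rewrite kadj ?gadj//.
  by apply/mem_set; exact: gball'.
by apply/mem_set; exact: gball'.
Qed.

Lemma rgraph_iso_sym (G H : rgraph) : rgraph_iso G H -> rgraph_iso H G.
Proof.
move=> [f [[g fK gK] froot fadj]]; exists g; split.
- by exists f.
- by rewrite -froot fK.
- by move=> x y; rewrite -fadj !gK.
Qed.

Lemma rgraph_iso_measurable (G H : rgraph) (A : set rgraph) :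
  rgraph_iso G H -> measurable A -> A G <-> A H.
Proof.
move=> GH; apply: (@smallest_sub _ _ _ [set A : set rgraph | A G <-> A H]).
  split=> /=.
  - by [].
  - by move=> B /= [GB HB]; split=> -[_ BN]; split=> // /[dup] ?; tauto.
  - move=> F /= FP; split=> -[n _ Fn]; exists n => //; exact/FP.
move=> B /= [r [K ->]] /=; split; first exact: rball_iso_rgraph_iso.
by apply: rball_iso_rgraph_iso; exact: rgraph_iso_sym.
Qed.

(* One step of simple random walk jumps to a uniform element of [moves x]: a
   uniform neighbour of [x], or [x] itself if [x] is isolated. *)
Definition moves (G : graph) (x : G) : {fset G} :=
  if nbrs x == fset0 then [fset x]%fset else nbrs x.

(* [walk_prob R n x y] is the probability that X_n = y given that X_0 = x. *)
Fixpoint walk_prob (R : realType) (G : graph) (n : nat) (x y : G) : R :=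
  if n is m.+1 then
    \sum_(z <- moves x) #|` moves x|%:R^-1 * walk_prob R m z y
  else (x == y)%:R.

(* [walk_expect n F] is the conditional expectation of F(X_n) given
   (G, root), the walk being started at X_0 = root; [F] is nonnegative. *)
Definition walk_expect (R : realType) (G : rgraph) (n : nat)
    (F : G -> \bar R) : \bar R :=
  (\esum_(y in [set: G]) ((walk_prob R n (root G) y)%:E * F y))%E.

Section random_rooted_graphs.
Context d (T : measurableType d) (R : realType) (P : probability T R).
Variable X : {RV P >-> rgraph}.

(* The law of (G, X_n), where (G, X_0) is the random rooted graph [X]. *)
Definition walk_law (n : nat) (A : set rgraph) : \bar R :=
  (\int[P]_w walk_expect n (fun y : X w => (\1_A (RGraph y))%:E))%E.

Definition stationary : Prop :=
  forall A : set rgraph, measurable A -> walk_law 0 A = walk_law 1 A.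

Definition annealed_polynomial_growth : Prop :=
  exists c d : R, [/\ 0 < c, 0 < d &
    forall r : nat, (1 <= r)%N ->
      (\int[P]_w counting (gball (root (X w)) r) <= (c * r%:R `^ d)%:E)%E].

End random_rooted_graphs.

(* Main.v *)
Require Import Defs.
From mathcomp Require Import lra measurable_realfun.

Import Order.TTheory GRing.Theory Num.Theory.

Set Implicit Arguments.
Unset Strict Implicit.
Unset Printing Implicit Defensive.

(** The walk on a fixed rooted graph is reversible for the measure [deg], the
    number of moves available at a vertex.  Let [u_n] be the density of the
    law of [X_n] with respect to [deg], let [S_n] be the entropy
    [- \sum deg u_n ln u_n], and let [M_n] be the mean of
    [(1 + d(X_0, X_n))^2].  By reversibility [u_(n+1)] is the average of [u_n]
    over neighbours, so both increments are sums over edges [z -- x]: the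
    entropy increment [S_(n+1) - S_n] is a sum of Jensen gaps, each at least
    [(sqrt u_n(x) - sqrt u_(n+1)(z))^2], while [M_(n+2) - M_n] is the sum of
    [(u_(n+1)(z) - u_n(x)) (f(x)^2 - f(z)^2)] with [f = 1 + d(X_0, .)].  As
    [|f(x)^2 - f(z)^2| <= 3 f(z)], the inequality of arithmetic and geometric
    means gives, for every [dl > 0],
    [M_(n+2) <= M_n + 4 dl M_(n+1) + 9 / (4 dl) (S_(n+1) - S_n)]
    ([displacement_entropy_step], [moment_step]).

    This inequality is linear, so it survives averaging over the random graph.
    Polynomial growth bounds the averaged entropy by [O(ln n)]
    ([Rintegral_entropy]).  If the averaged [M_n] were eventually larger than
    [K n], the choice of [dl] of order [1/n] would bound the increment of its
    logarithm by [1/2 (ln (n+1) - ln n)] plus [O(1/K)] times the entropy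
    increment; for large [K] this sums to at most [3/4 ln n], a contradiction
    ([linear_bound_infinitely_often]).  Thus the averaged second moment is at most
    [K n] for infinitely many [n], and Markov's inequality concludes.

    The averaging needs measurability: a quantity that depends only on a ball
    around the root is measurable because there are only countably many finite
    balls ([measurable_local], [measurable_ball_sum]). *)

(** * Entropy and displacement for one step of a reversible walk *)

Section entropy_and_displacement.
Variable R : realType.
Implicit Types a m : R.

Lemma ln_le_subr1 (x : R) : 0 < x -> ln x <= x - 1.
Proof.
move=> x0; rewrite -{1}(subrKC 1 x); apply: le_ln1Dx; lra.
Qed.

(** The right-hand side is the Bregman divergence of [x ln x]; writing both
    numbers as squares reduces the bound to [ln x <= x - 1] at
    [x = sqrt (m / a)]. *)
Lemma hellinger_le_entropy a m : 0 <= a -> 0 < m ->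
  (Num.sqrt a - Num.sqrt m) ^+ 2 <= a * ln a - a * ln m - a + m.
Proof.
rewrite le_eqVlt => /predU1P[<- m0|a0 m0].
  by rewrite sqrtr0 sub0r sqrrN sqr_sqrtr ?(ltW m0)// !mul0r !subr0 add0r.
have p0 : 0 < Num.sqrt a by rewrite sqrtr_gt0.
have q0 : 0 < Num.sqrt m by rewrite sqrtr_gt0.
rewrite -{2 3 4 5}(sqr_sqrtr (ltW a0)) -{2 3}(sqr_sqrtr (ltW m0)).
move: (Num.sqrt a) (Num.sqrt m) p0 q0 => p q p0 q0.
rewrite !lnXn// !mulr2n.
have := ln_le_subr1 (divr_gt0 q0 p0); rewrite ln_div// => lnpq.
have : p ^+ 2 * (ln q - ln p) <= p ^+ 2 * (q / p - 1).
  by rewrite ler_pM2l// exprn_gt0.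
have -> : p ^+ 2 * (q / p - 1) = p * q - p ^+ 2.
  by rewrite -{2}(divfK (lt0r_neq0 p0) q); lra.
by rewrite !expr2; nra.
Qed.

(** The contribution of one edge to the displacement, split so that the first
    part is absorbed by the entropy and the second by the second moment:
    [m - u] is factored through square roots because only their difference is
    controlled by the entropy. *)
Lemma hellinger_young (u m f g dl : R) : 0 < dl -> 0 <= u -> 0 <= m ->
    `|g| <= 3 * f ->
  (m - u) * g <= 9 / (4 * dl) * (Num.sqrt u - Num.sqrt m) ^+ 2
                 + 2 * dl * ((m + u) * f ^+ 2).
Proof.
move=> dl0 u0 m0 gf.
rewrite -{1 3}(sqr_sqrtr u0) -{1 3}(sqr_sqrtr m0).
move: (Num.sqrt u) (Num.sqrt m) (sqrtr_ge0 u) (sqrtr_ge0 m) => p q p0 q0.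
have f0 : 0 <= f by have := normr_ge0 g; lra.
have step1 : (q ^+ 2 - p ^+ 2) * g <= `|p - q| * (p + q) * (3 * f).
  apply: le_trans (ler_norm _) _; rewrite normrM.
  have -> : q ^+ 2 - p ^+ 2 = - ((p - q) * (p + q)) by lra.
  rewrite normrN normrM (ger0_norm (addr_ge0 p0 q0)).
  by rewrite ler_wpM2l// mulr_ge0// addr_ge0.
apply: le_trans step1 _.
rewrite -(real_normK (num_real (p - q))).
move: `|p - q| (normr_ge0 (p - q)) => A A0.
have young : A * (p + q) * (3 * f) <=
    9 / (4 * dl) * A ^+ 2 + dl * ((p + q) * f) ^+ 2.
  have : 0 <= (3 / (2 * dl) * A - (p + q) * f) ^+ 2 * dl.
    by rewrite mulr_ge0 ?sqr_ge0// ltW.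
  have -> : (3 / (2 * dl) * A - (p + q) * f) ^+ 2 * dl =
    9 / (4 * dl) * A ^+ 2 + dl * ((p + q) * f) ^+ 2 - A * (p + q) * (3 * f).
    have dlK : dl * dl^-1 = 1 by rewrite divff ?gt_eqF.
    rewrite !invfM; move: dl^-1 dlK => e dlK; rewrite !expr2.
    set X := (p + q) * f.
    transitivity (9 / 4 * e * (A * A) * (dl * e) - 3 * A * X * (dl * e)
                  + dl * (X * X)); first lra.
    by rewrite dlK /X; lra.
  by rewrite subr_ge0.
apply: le_trans young _; rewrite lerD2l.
rewrite (mulrC 2) -mulrA ler_pM2l// exprMn mulrA ler_wpM2r ?sqr_ge0//.
have := sqr_ge0 (p - q); rewrite !expr2; lra.
Qed.

(** One step of a reversible walk with edge weights [a] and reversible measure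
    [pi]; [u], [m] and [u2] are three consecutive densities.  The hypotheses on
    [\sum_z a x z] are restricted to the supports because [I] is meant to be a
    finite piece of an infinite graph, whose boundary vertices have lost some
    of their edges.  The displacement is that of two steps: over a single step it
    involves the differences [u x - u z] across edges, on which the entropy of
    a walk without laziness gives no information; over two steps it involves
    the oscillation of [u] around its average [m z] over the neighbours of
    [z], which is what the entropy gain measures. *)
Lemma displacement_entropy_step (I : finType) (a : I -> I -> R)
    (pi u m u2 f : I -> R) (dl : R) :
    0 < dl -> (forall x y, 0 <= a x y) -> (forall x y, a x y = a y x) ->
    (forall x, 0 < pi x) -> (forall x, 0 <= u x) ->
    (forall x, u x != 0 -> \sum_z a x z = pi x) ->
    (forall z, m z != 0 -> \sum_x a z x = pi z) ->
    (forall z, pi z * m z = \sum_x a z x * u x) ->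
    (forall x, pi x * u2 x = \sum_z a x z * m z) ->
    (forall z x, a z x != 0 -> `|f x ^+ 2 - f z ^+ 2| <= 3 * f z) ->
  \sum_x pi x * u2 x * f x ^+ 2 <=
  \sum_x pi x * u x * f x ^+ 2 + 4 * dl * (\sum_x pi x * m x * f x ^+ 2)
  + 9 / (4 * dl) * (\sum_x pi x * (u x * ln (u x))
                    - \sum_x pi x * (m x * ln (m x))).
Proof.
move=> dl0 a0 aC pi0 u0 upi mpi mE u2E fgrad.
have m0 z : 0 <= m z.
  rewrite -(pmulr_rge0 _ (pi0 z)) mE sumr_ge0// => x _; exact: mulr_ge0.
(* Where the new density vanishes, so did the old one at all neighbours; this
   covers the points where [ln (m z)] is a default value. *)
have am0 z x : m z = 0 -> a z x * u x = 0.
  move=> mz; have : \sum_x a z x * u x = 0 by rewrite -mE mz mulr0.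
  move=> /eqP; rewrite psumr_eq0 => [/allP /(_ x)|y _]; last exact: mulr_ge0.
  by rewrite mem_index_enum => /(_ isT)/eqP.
(* Sums over vertices become sums over edges. *)
have uE (h : I -> R) : \sum_x pi x * u x * h x = \sum_z \sum_x a z x * u x * h x.
  rewrite exchange_big; apply: eq_bigr => x _.
  rewrite -mulr_suml; congr (_ * _).
  rewrite -mulr_suml; have [->|ux] := eqVneq (u x) 0; first by rewrite !mulr0.
  by congr (_ * _); rewrite -(upi x ux); apply: eq_bigr => z _; rewrite aC.
have mE1 (h : I -> R) : \sum_z pi z * m z * h z = \sum_z \sum_x a z x * m z * h z.
  apply: eq_bigr => z _; have [mz|mz] := eqVneq (m z) 0.
    by rewrite mz mulr0 mul0r big1// => x _; rewrite mulr0 mul0r.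
  by rewrite -(mpi z mz) -!mulr_suml.
have mE2 (h : I -> R) : \sum_z pi z * m z * h z = \sum_z \sum_x a z x * u x * h z.
  by apply: eq_bigr => z _; rewrite mE mulr_suml.
have u2E' : \sum_x pi x * u2 x * f x ^+ 2 = \sum_z \sum_x a z x * m z * f x ^+ 2.
  rewrite exchange_big; apply: eq_bigr => x _; rewrite u2E mulr_suml.
  by apply: eq_bigr => z _; rewrite aC.
(* Subtracting [f z ^+ 2] is free, since [\sum_x a z x * (m z - u x) = 0]. *)
have disp : \sum_x pi x * u2 x * f x ^+ 2 - \sum_x pi x * u x * f x ^+ 2 =
    \sum_z \sum_x a z x * ((m z - u x) * (f x ^+ 2 - f z ^+ 2)).
  have -> : \sum_z \sum_x a z x * ((m z - u x) * (f x ^+ 2 - f z ^+ 2)) =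
      \sum_z \sum_x a z x * m z * f x ^+ 2 - \sum_z \sum_x a z x * u x * f x ^+ 2
      - (\sum_z \sum_x a z x * m z * f z ^+ 2
         - \sum_z \sum_x a z x * u x * f z ^+ 2).
    rewrite -!sumrB; apply: eq_bigr => z _; rewrite -!sumrB.
    by apply: eq_bigr => x _; lra.
  by rewrite -(mE1 (fun z => f z ^+ 2)) -(mE2 (fun z => f z ^+ 2)) subrr subr0
             u2E' -(uE (fun x => f x ^+ 2)).
have mass : 2 * (\sum_x pi x * m x * f x ^+ 2) =
    \sum_z \sum_x a z x * ((m z + u x) * f z ^+ 2).
  rewrite mulr_natl mulr2n {1}mE1 mE2 -big_split; apply: eq_bigr => z _.
  by rewrite -big_split; apply: eq_bigr => x _ /=; lra.
have ent : \sum_x pi x * (u x * ln (u x)) - \sum_x pi x * (m x * ln (m x)) =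
    \sum_z \sum_x a z x * (u x * ln (u x) - u x * ln (m z) - u x + m z).
  have -> : \sum_z \sum_x a z x * (u x * ln (u x) - u x * ln (m z) - u x + m z) =
      \sum_z \sum_x a z x * u x * ln (u x)
      - \sum_z \sum_x a z x * u x * ln (m z)
      - (\sum_z \sum_x a z x * u x * 1 - \sum_z \sum_x a z x * m z * 1).
    rewrite -!sumrB; apply: eq_bigr => z _; rewrite -!sumrB.
    by apply: eq_bigr => x _; lra.
  rewrite -(mE1 (fun=> 1)) -(mE2 (fun=> 1)) subrr subr0.
  rewrite -(uE (fun x => ln (u x))) -(mE2 (fun z => ln (m z))).
  by congr (_ - _); apply: eq_bigr => x _; rewrite mulrA.
rewrite -addrA -lerBlDl disp ent.
have -> : 4 * dl * (\sum_x pi x * m x * f x ^+ 2) =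
    2 * dl * (2 * (\sum_x pi x * m x * f x ^+ 2)) by lra.
rewrite mass !mulr_sumr -big_split; apply: ler_sum => z _ /=.
rewrite !mulr_sumr -big_split; apply: ler_sum => x _ /=.
have [->|azx] := eqVneq (a z x) 0; first by rewrite !mul0r !mulr0 addr0.
rewrite (mulrCA (2 * dl)) (mulrCA (9 / _)) -mulrDr ler_wpM2l//.
apply: le_trans (hellinger_young dl0 (u0 x) (m0 z) (fgrad z x azx)) _.
rewrite addrC lerD2l ler_wpM2l//.
  by rewrite divr_ge0// mulr_ge0// ltW.
have [mz|mz] := eqVneq (m z) 0; last first.
  by rewrite hellinger_le_entropy// lt_neqAle eq_sym mz m0.
have /eqP := am0 z x mz; rewrite mulf_eq0 (negbTE azx) => /eqP ->.
by rewrite mz !mul0r sqrtr0 !subr0 addr0 expr0n.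
Qed.

End entropy_and_displacement.

(** * A recursion that forces linear growth infinitely often *)

Section diffusive_times.
Variables (R : realType) (m s : nat -> R) (A B : R).
Hypotheses (m_ge0 : forall n, 0 <= m n) (B_ge0 : 0 <= B).
Hypothesis s_log : forall n, s n <= A + B * ln n.+1%:R.
Hypothesis m_step : forall n dl, 0 < dl ->
  m n.+2 <= m n + 4 * dl * m n.+1 + 9 / (4 * dl) * (s n.+1 - s n).

(* Letting [dl] tend to [0] shows that the entropy cannot decrease; the value
   below is small enough. *)
Let s_incr n : s n <= s n.+1.
Proof.
rewrite leNgt; apply/negP => sn.
pose h := s n - s n.+1; have h0 : 0 < h by rewrite subr_gt0.
pose c := m n + m n.+1; have c0 : 0 <= c by rewrite addr_ge0.
pose t := h / (c + h); have ch0 : 0 < c + h by rewrite ltr_wpDl.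
have t0 : 0 < t by rewrite divr_gt0.
have t1 : t <= 1 by rewrite ler_pdivrMr// mul1r lerDr.
have tc : t * c <= h.
  by rewrite mulrAC ler_pdivrMr// ler_pM2l// lerDl ltW.
have := m_step n (divr_gt0 t0 (ltr0n R 4)).
have -> : 4 * (t / 4) = t by rewrite mulrC divfK// pnatr_eq0.
have -> : s n.+1 - s n = - h by rewrite /h opprB.
move=> step; have := le_trans (m_ge0 n.+2) step.
rewrite mulrN subr_ge0 mulrAC ler_pdivrMr// => ht.
have : t * m n.+1 <= m n.+1 by rewrite ler_piMl.
move: ht tc; rewrite /c; have := m_ge0 n; have := m_ge0 n.+1.
by nra.
Qed.

(* Makes [18 / K * B <= 1 / 4]: of the exponent [1] that linear growth requires,
   one half is used by the choice of [dl], one quarter by the entropy. *)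
Let K : R := 72 * (B + 1).
Let K_gt0 : 0 < K. Proof. by rewrite mulr_gt0// ltr_wpDl. Qed.
(* The recursion is of order two; for sums of consecutive terms it is of order
   one. *)
Let v n : R := m n + m n.+1.
Let Phi n : R := ln (v n) - 1 / 2 * ln n%:R - 18 / K * s n.

(* The case [dl = 1 / (8 (n + 1))]. *)
Let v_step n : v n.+1 <= (1 + 1 / 2 * n.+1%:R^-1) * v n
                         + 18 * n.+1%:R * (s n.+1 - s n).
Proof.
have n0 : 0 < n.+1%:R :> R by rewrite ltr0n.
have dl0 : 0 < (8 * n.+1%:R)^-1 :> R by rewrite invr_gt0 mulr_gt0.
have := m_step n dl0; rewrite /v !invfM !invrK.
have := m_ge0 n; have := s_incr n; have := m_ge0 n.+1.
have e0 : 0 < n.+1%:R^-1 :> R by rewrite invr_gt0.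
move: n.+1%:R^-1 e0 => e e0; move: (n.+1%:R) (s n.+1 - s n) => N h.
nra.
Qed.

Let Phi_step n : (0 < n)%N -> K * n.+1%:R <= v n -> 0 < v n.+1 ->
  Phi n.+1 <= Phi n.
Proof.
move=> n0 vn vn1.
have N0 : 0 < n%:R :> R by rewrite ltr0n.
have N1 : 0 < n.+1%:R :> R by rewrite ltr0n.
have v0 : 0 < v n by apply: lt_le_trans vn; rewrite mulr_gt0.
have h0 : 0 <= s n.+1 - s n by rewrite subr_ge0.
have lnn : n.+1%:R^-1 <= ln n.+1%:R - ln n%:R :> R.
  have := ln_le_subr1 (divr_gt0 N0 N1); rewrite ln_div//.
  have -> : n%:R / n.+1%:R = 1 - n.+1%:R^-1 :> R.
    by rewrite -{1}(addrK 1 n%:R) natr1 mulrBl mul1r divff ?gt_eqF.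
  move: n.+1%:R^-1 (ln n%:R) (ln n.+1%:R) => x y z; lra.
have : v n.+1 / v n <= 1 + 1 / 2 * n.+1%:R^-1 + 18 / K * (s n.+1 - s n).
  rewrite ler_pdivrMr//; apply: le_trans (v_step n) _.
  rewrite [leRHS]mulrDl lerD2l -!mulrA ler_pM2l//.
  by rewrite (mulrCA K^-1) mulrC ler_wpM2l// ler_pdivlMl.
have := ln_le_subr1 (divr_gt0 vn1 v0); rewrite ln_div// /Phi.
move: (v n.+1 / v n) (ln (v n.+1)) (ln (v n)) (ln n%:R) (ln n.+1%:R) lnn.
move: n.+1%:R^-1 (s n) (s n.+1) (18 / K) => *. lra.
Qed.

(** If [m] were eventually above [K n], then
    [ln (v n) - 1/2 ln n - 18 / K s n] would be nonincreasing from there on,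
    and yet at least [1/4 ln n] up to a constant. *)
Lemma linear_bound_infinitely_often :
  exists2 C : R, 0 < C &
  forall N, exists n, [/\ (N <= n)%N, (0 < n)%N & m n <= C * n%:R].
Proof.
exists K => // N; apply: contrapT => noex.
have big n : (N < n)%N -> K * n.+1%:R < v n.
  move=> Nn; rewrite ltNge; apply/negP => vn; apply: noex; exists n.+1; split=> //.
    by rewrite (leq_trans (ltnW Nn)).
  by apply: le_trans vn; rewrite /v lerDr.
have dec k : Phi (N.+1 + k) <= Phi N.+1.
  elim: k => [|k IH]; first by rewrite addn0.
  apply: le_trans IH; rewrite addnS; apply: Phi_step => //.
    by rewrite ltW// big// leq_addr.
  apply: lt_trans (big _ _); first by rewrite mulr_gt0.
  by rewrite ltnS (leq_trans (leqnSn N))// leq_addr.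
have low n : (N < n)%N -> ln K + 1 / 4 * ln n.+1%:R - 18 / K * A <= Phi n.
  move=> Nn; have n0 : (0 < n)%N by apply: leq_trans Nn.
  have := big n Nn => /ltW Kv.
  have N1 : 0 < n.+1%:R :> R by rewrite ltr0n.
  have lnv : ln K + ln n.+1%:R <= ln (v n).
    have Kn0 : 0 < K * n.+1%:R by rewrite mulr_gt0.
    by rewrite -lnM ?posrE// ler_ln ?posrE// (lt_le_trans Kn0).
  have lnn : ln n%:R <= ln n.+1%:R :> R.
    by rewrite ler_ln ?posrE ?ltr0n// ler_nat.
  have lnn0 : 0 <= ln n.+1%:R :> R by rewrite ln_ge0// ler1n.
  have : 18 / K * s n <= 18 / K * (A + B * ln n.+1%:R).
    by rewrite ler_wpM2l// divr_ge0// ltW.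
  have : 18 / K * (B * ln n.+1%:R) <= 1 / 4 * ln n.+1%:R.
    rewrite mulrA ler_wpM2r// mulrAC ler_pdivrMr// /K; lra.
  rewrite /Phi; lra.
set x := 4 * (Phi N.+1 - ln K + 18 / K * A) + 1.
have [k kx] : exists k, expR x <= (N.+1 + k).+1%:R.
  exists (Num.bound (expR x)); have := archi_boundP (ltW (expR_gt0 x)).
  move=> /ltW/le_trans; apply; rewrite ler_nat -addnS.
  exact: leq_trans (leqnSn _) (leq_addl _ _).
have xln : x <= ln (N.+1 + k).+1%:R.
  by rewrite -{1}(expRK x) ler_ln// posrE ?expR_gt0// ltr0n.
have := dec k; have := low (N.+1 + k)%N; rewrite ltnS leq_addr => /(_ isT).
move: xln; rewrite /x; lra.
Qed.

End diffusive_times.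

(** * Balls, distances and the simple random walk *)

Section balls.
Variable G : graph.
Implicit Types (x y z : G) (n r : nat).

Lemma path_length0 x y : path_length x y 0 <-> x = y.
Proof.
by split=> [[p [_ <- /size0nil ->]]//|->]; exists [::].
Qed.

Lemma path_lengthS x y n :
  path_length x y n.+1 <-> exists2 z, path_length x z n & adj G z y.
Proof.
split=> [[p]|[z [p [xp pz pn]] zy]]; last first.
  by exists (rcons p y); rewrite rcons_path last_rcons size_rcons pz xp pn.
case: (lastP p) => [[] //|{}p z []]; rewrite rcons_path last_rcons size_rcons.
by move=> /andP[xp zy] <- [pn]; exists (last x p) => //; exists p.
Qed.

Lemma gballS x y z r : gball x r y -> adj G y z -> gball x r.+1 z.
Proof.
by move=> [n nr xyn] yz; exists n.+1 => //; apply/path_lengthS; exists y.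
Qed.

Lemma gball_le x r r' : (r <= r')%N -> gball x r `<=` gball x r'.
Proof. by move=> rr' y [n nr xyn]; exists n => //; exact: leq_trans rr'. Qed.

Lemma gball_refl x r : gball x r x.
Proof. by exists 0%N => //; apply/path_length0. Qed.

Lemma finite_gball x r : finite_set (gball x r).
Proof.
elim: r => [|r IH].
  apply: (@sub_finite_set _ _ [set x]) => [y [n]|]; last exact: finite_set1.
  by rewrite leqn0 => /eqP -> /path_length0 ->.
apply: (@sub_finite_set _ _
  (gball x r `|` \bigcup_(y in gball x r) [set` nbrs y])); last first.
  rewrite finite_setU; split=> //; apply: bigcup_finite => // y _.
  exact: finite_fset.
move=> z [n]; rewrite leq_eqVlt => /predU1P[->|nr xzn]; last first.
  by left; exists n.
by move=> /path_lengthS[y xyr yz]; right; exists y => //; exists r.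
Qed.

Lemma movesC x y : (y \in moves x) = (x \in moves y).
Proof.
have main u v : v \in moves u -> u \in moves v.
  rewrite /moves; case: eqP => [u0|_].
    by rewrite inE => /eqP->; rewrite u0 eqxx inE.
  case: eqP => [v0|_]; last by rewrite nbrs_sym.
  by rewrite nbrs_sym v0 inE.
by apply/idP/idP; exact: main.
Qed.

Lemma moves_gt0 x : (0 < #|` moves x|)%N.
Proof.
rewrite cardfs_gt0 /moves; case: ifPn => // _.
by apply/negP => /eqP/fsetP/(_ x); rewrite !inE eqxx.
Qed.

Lemma moves_adj x y : y \in moves x -> y = x \/ adj G x y.
Proof.
by rewrite /moves; case: ifP => _; [rewrite inE => /eqP; left|right].
Qed.

Lemma gball_moves x y z r : gball x r y -> z \in moves y -> gball x r.+1 z.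
Proof.
move=> xy /moves_adj[->|]; last exact: gballS.
exact: gball_le xy.
Qed.

End balls.

Section walk.
Variables (R : realType) (G : graph).
Implicit Types (x y z : G) (n r : nat).
Local Notation deg x := (#|` moves x|%:R : R).

Lemma deg_gt0 x : 0 < deg x.
Proof. by rewrite ltr0n moves_gt0. Qed.

Lemma walk_prob_ge0 n x y : 0 <= walk_prob R n x y.
Proof.
elim: n x => [|n IH] x /=; first exact: ler0n.
by apply: sumr_ge0 => z _; rewrite mulr_ge0// invr_ge0.
Qed.

Lemma walk_prob_le1 n x y : walk_prob R n x y <= 1.
Proof.
elim: n x => [|n IH] x /=; first by rewrite lern1 leq_b1.
apply: (@le_trans _ _ (\sum_(z <- moves x) (deg x)^-1)).
  by apply: ler_sum => z _; rewrite ler_piMr// invr_ge0.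
rewrite big_const_seq count_predT iter_addr_0 -[_ *+ size _]mulr_natl.
by rewrite divff// gt_eqF// deg_gt0.
Qed.

(** The walk decomposed at its last step instead of its first.  In terms of
    densities with respect to the number of moves this says that they evolve by
    averaging over neighbours, which is the form of reversibility used
    below. *)
Lemma walk_probSr n x y :
  walk_prob R n.+1 x y = \sum_(z <- moves y) walk_prob R n x z / deg z.
Proof.
elim: n x => [|n IH] x.
  have -> : walk_prob R 1 x y = (y \in moves x)%:R / deg x.
    rewrite /= -mulr_sumr mulrC; congr (_ * _).
    have [yx|yx] := boolP (y \in moves x).
      rewrite (big_fsetD1 y)//= eqxx big_seq big1 ?addr0// => z.
      by rewrite !inE => /andP[/negbTE ->].
    by rewrite big_seq big1// => z zx; case: eqP => // zy; rewrite -zy zx in yx.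
  rewrite movesC; have [yx|yx] := boolP (x \in moves y).
    rewrite (big_fsetD1 x)//= eqxx big_seq big1 ?addr0// => z.
    by rewrite !inE eq_sym => /andP[/negbTE -> _]; rewrite mul0r.
  rewrite mul0r big_seq big1// => z zy; rewrite /=.
  by case: eqP => [xz|]; rewrite ?mul0r// xz zy in yx *.
transitivity (\sum_(z <- moves x) (deg x)^-1 * walk_prob R n.+1 z y) => //.
under eq_bigr do rewrite IH mulr_sumr.
rewrite exchange_big; apply: eq_bigr => z _ /=.
by rewrite mulr_suml; apply: eq_bigr => w _; rewrite mulrA.
Qed.

Lemma walk_prob_gball n x y : walk_prob R n x y != 0 -> gball x n y.
Proof.
elim: n y => [|n IH] y.
  rewrite /=; have [->|_] := eqVneq x y; last by rewrite eqxx.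
  by move=> _; exact: gball_refl.
rewrite walk_probSr => sum0; apply: contrapT => yNball; move/negP: sum0; apply.
apply/eqP; rewrite big_seq big1// => z zy.
have [->|/IH xz] := eqVneq (walk_prob R n x z) 0; first by rewrite mul0r.
by exfalso; apply: yNball; apply: gball_moves xz _; rewrite movesC.
Qed.

(** Sums are carried out over a finite piece [D] of the graph, which cuts off
    edges at its boundary; the hypothesis ensures that nothing is lost there. *)
Lemma sum_moves (D : {fset G}) z (h : G -> R) :
    (forall x, x \in moves z -> x \notin D -> h x = 0) ->
  \sum_(x : D) (val x \in moves z)%:R * h (val x) = \sum_(x <- moves z) h x.
Proof.
move=> h0.
rewrite -(big_seq_fsetE _ D xpredT (fun x => (x \in moves z)%:R * h x)).
transitivity (\sum_(x <- (D `&` moves z)%fset) (x \in moves z)%:R * h x).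
  apply/esym/big_fset_incl; first exact: fsubsetIl.
  by move=> x xD; rewrite inE xD /= => /negbTE ->; rewrite mul0r.
transitivity (\sum_(x <- (D `&` moves z)%fset) h x).
  by apply: eq_big_seq => x; rewrite inE => /andP[_ ->]; rewrite mul1r.
apply: big_fset_incl; first exact: fsubsetIr.
by move=> x xz; rewrite inE xz andbT; exact: h0.
Qed.

End walk.

Section hops.
Variable G : rgraph.
Implicit Types (x y z : G) (n r : nat).

(** The graph distance to the root as a natural number, with value [0] outside
    of the component of the root. *)
Definition hops x : nat :=
  if pselect (exists n, `[< path_length (root G) x n >]) is left e then ex_minn e
  else 0.

Lemma hops_le x n : path_length (root G) x n -> (hops x <= n)%N.
Proof.
move=> /asboolP xn; rewrite /hops; case: pselect => [e|//].
by case: ex_minnP => k _; exact.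
Qed.

Lemma path_hops x n : path_length (root G) x n -> path_length (root G) x (hops x).
Proof.
move=> /asboolP xn; rewrite /hops; case: pselect => [e|]; last by case; exists n.
by case: ex_minnP => k /asboolP.
Qed.

Lemma gdist_hops (R : realType) x r :
  gball (root G) r x -> gdist R (root G) x = (hops x)%:R%:E.
Proof.
move=> [n _ xn]; apply/eqP; rewrite eq_le; apply/andP; split.
  by apply: ereal_inf_lbound; exists (hops x) => //; exact: path_hops xn.
by apply: le_ereal_inf_tmp => _ [k xk <-]; rewrite lee_fin ler_nat hops_le.
Qed.

Lemma hops_moves x y : y \in moves x -> (hops y <= (hops x).+1)%N.
Proof.
move=> /moves_adj[->//|xy].
have [[n /path_hops xn]|Nx] := pselect (exists n, path_length (root G) x n).
  by apply: hops_le; apply/path_lengthS; exists x.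
rewrite /hops; case: pselect => // ey; exfalso; apply: Nx.
have [n /asboolP yn] := ey.
by exists n.+1; apply/path_lengthS; exists y => //; rewrite /adj nbrs_sym.
Qed.

End hops.

(** * Functionals of a ball and their increments *)

Section finite_balls.
Implicit Types (G : rgraph) (r : nat).

Definition fball G r : {fset G} := fset_set (gball (root G) r).

Lemma in_fball G r (x : G) : x \in fball G r <-> gball (root G) r x.
Proof.
rewrite /fball in_fset_set; last exact: finite_gball.
by split=> [/set_mem|/mem_set].
Qed.

Lemma fball_le G r r' : (r <= r')%N -> (fball G r `<=` fball G r')%fset.
Proof.
by move=> rr'; apply/fsubsetP => x /in_fball xr; apply/in_fball; exact: gball_le xr.
Qed.

Lemma fballS G r (x y : G) : x \in fball G r -> y \in moves x -> y \in fball G r.+1.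
Proof. by move=> /in_fball xr yx; apply/in_fball; exact: gball_moves yx. Qed.

End finite_balls.

Section ball_functionals.
Variable R : realType.
Implicit Types (G : rgraph) (n r : nat) (g : R -> nat -> nat -> R).

(** All the quantities that get averaged over the random graph have this form,
    so that measurability has to be proved only once. *)
Definition ball_sum r n g G : R :=
  \sum_(y <- fball G r) g (walk_prob R n (root G) y) #|` moves y| (hops y).

Lemma ball_sum_widen r n g G : (n <= r)%N -> (forall k d, g 0 k d = 0) ->
  ball_sum n n g G = ball_sum r n g G.
Proof.
move=> nr g0; apply: big_fset_incl; first exact: fball_le.
move=> y _ yn; have [->|/walk_prob_gball/in_fball] :=
  eqVneq (walk_prob R n (root G) y) 0; first exact: g0.
by rewrite (negbTE yn).
Qed.

Lemma walk_prob_sum1 n G : ball_sum n n (fun p _ _ => p) G = 1.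
Proof.
elim: n => [|n IH].
  rewrite /ball_sum /= (big_fsetD1 (root G)) ?eqxx/=; last first.
    exact/in_fball/gball_refl.
  rewrite big_seq big1 ?addr0// => y.
  by rewrite !inE eq_sym => /andP[/negbTE ->].
rewrite (@ball_sum_widen n.+2)// -[RHS]IH (@ball_sum_widen n.+1)//.
rewrite /ball_sum.
under eq_bigr do rewrite walk_probSr.
rewrite (big_seq_fsetE _ _ xpredT (fun y => \sum_(z <- moves y) _)) /=.
transitivity (\sum_(y : fball G n.+2) \sum_(x : fball G n.+2)
   (val x \in moves (val y))%:R *
   (walk_prob R n (root G) (val x) / #|` moves (val x)|%:R)).
  apply: eq_bigr => y _; apply/esym.
  apply: (sum_moves (h := fun x => walk_prob R n (root G) x / #|` moves x|%:R)).
  move=> x _ xN.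
  have [->|/walk_prob_gball/in_fball xn] := eqVneq (walk_prob R n (root G) x) 0.
    by rewrite mul0r.
  by have := fsubsetP (fball_le G (leq_trans (leqnSn n) (leqnSn _))) x xn;
    rewrite (negbTE xN).
rewrite exchange_big /= -/(ball_sum n.+1 n (fun p _ _ => p) G).
rewrite -(@ball_sum_widen n.+1)// (@ball_sum_widen n.+2)//; last first.
  exact: leq_trans (leqnSn _).
rewrite /ball_sum.
rewrite (big_seq_fsetE _ (fball G n.+2) xpredT
  (fun y => walk_prob R n (root G) y)) /=.
apply: eq_bigr => x _; rewrite -mulr_suml.
have [->|/walk_prob_gball/in_fball xn] :=
  eqVneq (walk_prob R n (root G) (val x)) 0.
  by rewrite mul0r mulr0.
under eq_bigr do rewrite movesC -[(_ \in _)%:R]mulr1.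
rewrite (sum_moves (h := fun=> 1))// => [|y yx yN]; last first.
  have := fsubsetP (fball_le G (leqnSn n.+1)) y (fballS xn yx).
  by rewrite (negbTE yN).
rewrite big_const_seq count_predT iter_addr_0 mulrCA divff ?mulr1//.
by rewrite gt_eqF// deg_gt0.
Qed.

(** The distance is shifted by one because the gradient bound
    [|f x ^+ 2 - f z ^+ 2| <= 3 * f z] fails for the distance itself when [z] is
    the root. *)
Definition moment n : rgraph -> R := ball_sum n n (fun p _ d => p * d.+1%:R ^+ 2).

(** Minus the relative entropy of the law of the walk with respect to the
    number of moves. *)
Definition entropy n : rgraph -> R :=
  ball_sum n n (fun p k _ => - (k%:R * (p / k%:R * ln (p / k%:R)))).

Definition sq_disp n : rgraph -> R := ball_sum n n (fun p _ d => p * d%:R ^+ 2).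

Definition volume r : rgraph -> R := ball_sum r 0 (fun _ _ _ => 1).

Lemma moment_ge0 n G : 0 <= moment n G.
Proof. by apply: sumr_ge0 => y _; rewrite mulr_ge0 ?walk_prob_ge0// sqr_ge0. Qed.

Lemma entropy_ge0 n G : 0 <= entropy n G.
Proof.
apply: sumr_ge0 => y _; rewrite oppr_ge0 pmulr_rle0 ?deg_gt0//.
apply: mulr_ge0_le0; first by rewrite divr_ge0 ?walk_prob_ge0.
rewrite ln_le0// ler_pdivrMr ?deg_gt0// mul1r.
by apply: le_trans (walk_prob_le1 _ _ _ _) _; rewrite ler1n moves_gt0.
Qed.

Lemma sq_disp_le_moment n G : sq_disp n G <= moment n G.
Proof.
apply: ler_sum => y _; rewrite ler_wpM2l ?walk_prob_ge0//.
by rewrite lerXn2r ?nnegrE ?ler0n ?ler_nat.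
Qed.

Lemma moment_le n G : moment n G <= n.+1%:R ^+ 2.
Proof.
rewrite -[leRHS]mul1r -[X in X * _](walk_prob_sum1 n G) mulr_suml.
rewrite /moment /ball_sum !big_seq; apply: ler_sum => y /in_fball[k kn xk].
rewrite ler_wpM2l ?walk_prob_ge0// lerXn2r ?nnegrE ?ler0n ?ler_nat ?ltnS//.
exact: leq_trans (hops_le xk) kn.
Qed.

Lemma volume_ge0 r G : 0 <= volume r G.
Proof. exact: sumr_ge0. Qed.

Lemma volumeE r G : (volume r G)%:E = counting (gball (root G) r).
Proof.
rewrite /counting asboolT; last exact: finite_gball.
by rewrite /volume /ball_sum big_const_seq count_predT iter_addr_0.
Qed.

(** The entropy is at most the sum of the mean of the logarithm of the number of
    moves at [X_n] and of the Shannon entropy of [X_n], both of order the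
    logarithm of the volume.  The logarithm is bounded through its tangent at
    a free point [b], so that only the first moment of the volume of a random
    ball enters after averaging; [b] will be of the order of that moment. *)
Lemma entropy_le n G (b : R) : 0 < b ->
  entropy n G <= 2 * ln b + 2 * (volume n.+1 G / b).
Proof.
move=> b0; have bV : 0 < b^-1 by rewrite invr_gt0.
set V := volume n.+1 G.
have V0 : 0 <= V by exact: volume_ge0.
have cardV r : (r <= n.+1)%N -> #|` fball G r|%:R <= V.
  move=> rn; rewrite /V /volume /ball_sum big_const_seq count_predT iter_addr_0.
  by rewrite ler_nat fsubset_leq_card// fball_le.
apply: (@le_trans _ _ (ball_sum n n
    (fun p _ _ => p * (2 * ln b + V / b) + b^-1) G)).
  rewrite /entropy /ball_sum !big_seq; apply: ler_sum => y yn.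
  set p := walk_prob _ _ _ _; set k := #|` moves y|.
  have k0 : 0 < k%:R :> R by exact: deg_gt0.
  have kV : k%:R <= V.
    apply: le_trans (cardV _ (leqnn _)); rewrite ler_nat fsubset_leq_card//.
    by apply/fsubsetP => z; exact: fballS.
  have p0 : 0 <= p by exact: walk_prob_ge0.
  have -> : - (k%:R * (p / k%:R * ln (p / k%:R))) = - (p * ln (p / k%:R)).
    by rewrite mulrA (mulrC p) mulVKf ?gt_eqF.
  move: p0; rewrite le_eqVlt => /predU1P[<-|p0].
    by rewrite !mul0r oppr0 add0r ltW.
  rewrite ln_div//.
  have lnk : ln k%:R - ln b <= V / b.
    rewrite -ln_div//; apply: le_trans (ln_le_subr1 _) _; first exact: divr_gt0.
    by rewrite lerBlDr ler_wpDr// ler_wpM2r// ltW.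
  have lnp : - ln b - ln p <= (p * b)^-1.
    have pb0 : 0 < p * b by rewrite mulr_gt0.
    have := @ln_le_subr1 R (p * b)^-1; rewrite invr_gt0 => /(_ pb0).
    by rewrite lnV// lnM//; lra.
  have -> : - (p * (ln p - ln k%:R)) =
      p * (2 * ln b + (ln k%:R - ln b)) + p * (- ln b - ln p) by lra.
  rewrite lerD//; first by rewrite ler_pM2l// lerD2l.
  have -> : b^-1 = p * (p * b)^-1 by rewrite invfM mulVKf// gt_eqF.
  by rewrite ler_pM2l.
rewrite /ball_sum big_split /= -mulr_suml -/(ball_sum n n (fun p _ _ => p) G).
rewrite walk_prob_sum1 mul1r big_const_seq count_predT iter_addr_0 -mulr_natl.
have : #|` fball G n|%:R / b <= V / b.
  by rewrite ler_pM2r// cardV.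
lra.
Qed.

(** [displacement_entropy_step] on the ball of radius [n + 3], which contains
    all neighbours of the points that the walk can reach in [n + 2] steps. *)
Lemma moment_step n G (dl : R) : 0 < dl ->
  moment n.+2 G <= moment n G + 4 * dl * moment n.+1 G
                   + 9 / (4 * dl) * (entropy n.+1 G - entropy n G).
Proof.
move=> dl0; pose D := fball G n.+3.
pose pi (x : D) : R := #|` moves (val x)|%:R.
pose u k (x : D) : R := walk_prob R k (root G) (val x) / pi x.
pose a (x y : D) : R := (val y \in moves (val x))%:R.
have pi0 x : 0 < pi x by exact: deg_gt0.
have pK k x : pi x * u k x = walk_prob R k (root G) (val x).
  by rewrite /u mulrC divfK// gt_eqF.
(* Vertices charged by the walk have all their neighbours in [D]. *)
have near k (x : D) : u k x != 0 -> (k <= n.+2)%N -> \sum_z a x z = pi x.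
  move=> ux kn.
  under eq_bigr do rewrite /a -[(_ \in _)%:R]mulr1.
  rewrite (sum_moves (h := fun=> 1)).
    by rewrite big_const_seq count_predT iter_addr_0.
  move=> z zx zN; exfalso; move/negP: zN; apply.
  apply: (fsubsetP (@fball_le G k.+1 _ _)); first by rewrite ltnS.
  apply: fballS zx; apply/in_fball/(@walk_prob_gball R); move: ux.
  by apply: contra_neq => p0; rewrite /u p0 mul0r.
have evol k (x : D) : (k <= n.+2)%N -> pi x * u k.+1 x = \sum_z a x z * u k z.
  move=> kn; rewrite pK walk_probSr.
  rewrite (sum_moves (h := fun z => walk_prob R k (root G) z / #|` moves z|%:R))//.
  move=> z _ zN; have [->|/walk_prob_gball/in_fball zk] :=
    eqVneq (walk_prob R k (root G) z) 0; first by rewrite mul0r.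
  have := fsubsetP (@fball_le G k n.+3 (leqW kn)) _ zk.
  by rewrite (negbTE zN).
have := @displacement_entropy_step R D a pi (u n) (u n.+1) (u n.+2)
  (fun x => (hops (val x)).+1%:R) dl dl0.
have momE k : (k <= n.+3)%N -> moment k G =
    \sum_(x : D) pi x * u k x * (hops (val x)).+1%:R ^+ 2.
  move=> kn; rewrite /moment (@ball_sum_widen n.+3)//; last first.
    by move=> *; rewrite mul0r.
  by rewrite /ball_sum big_seq_fsetE; apply: eq_bigr => x _; rewrite pK.
have entE k : (k <= n.+3)%N -> entropy k G =
    - \sum_(x : D) pi x * (u k x * ln (u k x)).
  move=> kn; rewrite /entropy (@ball_sum_widen n.+3)//; last first.
    by move=> *; rewrite !mul0r mulr0 oppr0.
  by rewrite /ball_sum big_seq_fsetE -sumrN; apply: eq_bigr.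
rewrite -(momE n) -?(momE n.+1) -?(momE n.+2) ?(leqnSn, leqW)//.
have <- : entropy n.+1 G - entropy n G =
    \sum_(x : D) pi x * (u n x * ln (u n x))
    - \sum_(x : D) pi x * (u n.+1 x * ln (u n.+1 x)).
  rewrite (entE n.+1); last exact: leqW.
  by rewrite (entE n) ?opprK 1?addrC// !leqW.
apply=> //.
- by move=> x y; rewrite /a movesC.
- by move=> x; rewrite divr_ge0 ?walk_prob_ge0// ltW.
- by move=> x ux; apply: (near n) => //; rewrite leqW.
- by move=> x ux; apply: (near n.+1).
- by move=> x; apply: evol; rewrite leqW.
- by move=> x; exact: evol.
move=> z x; rewrite /a pnatr_eq0 eqb0 negbK => xz.
have := hops_moves xz; rewrite movesC in xz; have := hops_moves xz.
move: (hops _) (hops _) => h k; rewrite -!(ler_nat R) -!natr1.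
have := ler0n R h; have := ler0n R k; move: h%:R k%:R => {}h {}k h0 k0 hk kh.
rewrite ler_norml; apply/andP; split; nra.
Qed.

(** The values of [F] far from the root, such as an infinite distance to another
    component, have weight zero. *)
Lemma walk_expectE n G (F : G -> \bar R) (h : G -> R) :
    (forall y, gball (root G) n y -> F y = (h y)%:E) ->
    (forall y, gball (root G) n y -> 0 <= h y) ->
  walk_expect n F = (\sum_(y <- fball G n) walk_prob R n (root G) y * h y)%:E.
Proof.
move=> Fh h0; rewrite /walk_expect.
transitivity (\esum_(y in gball (root G) n) ((walk_prob R n (root G) y)%:E * F y))%E.
  rewrite [RHS]esum_mkcond; apply: eq_esum => y _; case: ifPn => // yN.
  have [->|/walk_prob_gball/mem_set yn] := eqVneq (walk_prob R n (root G) y) 0.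
    by rewrite mul0e.
  by rewrite yn in yN.
rewrite esum_fset; [|exact: finite_gball|]; last first.
  by move=> y /set_mem yn; rewrite Fh// -EFinM lee_fin mulr_ge0 ?walk_prob_ge0 ?h0.
rewrite fsbig_finite; last exact: finite_gball.
rewrite -sumEFin !big_seq; apply: eq_bigr => y /in_fball yn.
by rewrite Fh.
Qed.

Lemma walk_expect_gdist n G :
  walk_expect n (fun y : G => (gdist R (root G) y ^+ 2)%E) = (sq_disp n G)%:E.
Proof.
rewrite (@walk_expectE _ _ _ (fun y : G => (hops y)%:R ^+ 2))// => y yn.
  by rewrite (gdist_hops _ yn).
Qed.

End ball_functionals.

(** * Measurability of functionals of a ball *)

Section ball_isomorphism.
Variables (r : nat) (G H : rgraph) (f : G -> H).
Hypothesis f_root : f (root G) = root H.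
Hypothesis f_bij : set_bij (gball (root G) r) (gball (root H) r) f.
Hypothesis f_adj :
  {in gball (root G) r &, forall x y, adj H (f x) (f y) = adj G x y}.
Implicit Types (x y : G) (n k : nat).

Let ballT x n : (n <= r)%N -> path_length (root G) x n -> x \in gball (root G) r.
Proof. by move=> nr xn; apply/mem_set; exists n. Qed.

Let f_inj x y : gball (root G) r x -> gball (root G) r y -> f x = f y -> x = y.
Proof.
have [_ inj _] := f_bij.
by move=> xr yr /inj; apply; apply/mem_set.
Qed.

Lemma iso_path x n : (n <= r)%N -> path_length (root G) x n ->
  path_length (root H) (f x) n.
Proof.
elim: n x => [|n IH] x nr.
  by move=> /path_length0 <-; apply/path_length0.
move=> xn; have xr := ballT nr xn.
have /path_lengthS[z zn zx] := xn; apply/path_lengthS; exists (f z).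
  by apply: IH => //; exact: ltnW.
by rewrite f_adj//; exact: ballT (ltnW nr) zn.
Qed.

Lemma iso_path_lift w n : (n <= r)%N -> path_length (root H) w n ->
  exists2 x, path_length (root G) x n & f x = w.
Proof.
elim: n w => [|n IH] w nr.
  by move=> /path_length0 <-; exists (root G) => //; apply/path_length0.
move=> wn; have [_ _ surj] := f_bij.
have [|x xr xw] := surj w; first by exists n.+1.
exists x => //; have /path_lengthS[v vn vw] := wn.
have [z zn zv] := IH v (ltnW nr) vn; apply/path_lengthS; exists z => //.
rewrite -f_adj ?zv ?xw//; last exact/mem_set.
exact: ballT (ltnW nr) zn.
Qed.

Lemma iso_pathE x n : gball (root G) r x -> (n <= r)%N ->
  path_length (root H) (f x) n <-> path_length (root G) x n.
Proof.
move=> xr nr; split; last exact: iso_path.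
move=> /(iso_path_lift nr)[y yn /f_inj <-//]; by exists n.
Qed.

Lemma iso_gball x k : gball (root G) r x -> (k <= r)%N ->
  gball (root H) k (f x) <-> gball (root G) k x.
Proof.
move=> xr kr; split=> -[n nk] xn; exists n => //.
  by rewrite -iso_pathE// (leq_trans nk).
by rewrite iso_pathE// (leq_trans nk).
Qed.

Lemma iso_hops x : gball (root G) r x -> hops (f x) = hops x.
Proof.
move=> xr; have [n nr xn] := xr.
have fxn := iso_path nr xn.
apply/eqP; rewrite eqn_leq; apply/andP; split; apply: hops_le.
  by apply: iso_path (path_hops xn); apply: leq_trans nr; exact: hops_le.
rewrite -iso_pathE//; first exact: path_hops fxn.
by apply: leq_trans nr; exact: hops_le.
Qed.

Lemma iso_nbrs x k : (k < r)%N -> gball (root G) k x ->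
  nbrs (f x) = [fset f y | y in nbrs x]%fset.
Proof.
move=> kr xk; have xr := gball_le (ltnW kr) xk.
have nb y : y \in nbrs x -> gball (root G) r y.
  by move=> xy; apply: (gball_le kr); exact: gballS xk xy.
apply/fsetP => w; apply/idP/imfsetP => [xw|[y /= xy ->]].
  have wr : gball (root H) r w.
    by apply: (gball_le kr); apply: gballS xw; apply/iso_gball => //; exact: ltnW.
  have [_ _ surj] := f_bij; have [y yr yw] := surj w wr.
  exists y => //=; suff : adj G x y by [].
  by rewrite -f_adj ?yw//; exact/mem_set.
suff : adj H (f x) (f y) by [].
by rewrite f_adj//; apply/mem_set => //; exact: nb.
Qed.

Lemma iso_moves x k : (k < r)%N -> gball (root G) k x ->
  moves (f x) = [fset f y | y in moves x]%fset.
Proof.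
move=> kr xk; rewrite /moves (iso_nbrs kr xk).
have [->|x0] := eqVneq (nbrs x) fset0.
  by rewrite imfset0 eqxx imfset_fset1.
case: ifPn => // /eqP im0; have /fset0Pn[y xy] := x0.
by have := in_imfset imfset_key f xy; rewrite /= im0 inE.
Qed.

Let moves_inj x k : (k < r)%N -> gball (root G) k x -> {in moves x &, injective f}.
Proof.
move=> kr xk y z xy xz; apply: f_inj; apply: (gball_le kr); exact: gball_moves xk _.
Qed.

Lemma iso_card_moves x k : (k < r)%N -> gball (root G) k x ->
  #|` moves (f x)| = #|` moves x|.
Proof.
by move=> kr xk; rewrite (iso_moves kr xk) card_in_imfset//=; exact: moves_inj xk.
Qed.

(** Induction on the number of steps moves the starting point away from the
    root, so the ball must leave room for the remaining steps. *)
Lemma iso_walk_prob (R : realType) n k x y :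
    (k + n <= r)%N -> gball (root G) k x -> gball (root G) r y ->
  walk_prob R n (f x) (f y) = walk_prob R n x y.
Proof.
elim: n k x => [|n IH] k x kr xk yr /=.
  rewrite addn0 in kr; congr (nat_of_bool _)%:R.
  by apply/eqP/eqP => [/f_inj|->//]; apply=> //; exact: gball_le xk.
have kr' : (k < r)%N by apply: leq_trans kr; rewrite -addSnnS leq_addr.
rewrite (iso_card_moves kr' xk) (iso_moves kr' xk) big_imfset; last first.
  exact: moves_inj xk.
rewrite !big_seq; apply: eq_bigr => z /= xz; congr (_ * _).
by apply: (IH k.+1) => //; [rewrite addSnnS|exact: gball_moves xk xz].
Qed.

Lemma iso_fball k : (k <= r)%N -> fball H k = [fset f x | x in fball G k]%fset.
Proof.
move=> kr; apply/fsetP => w; apply/idP/imfsetP => /= [/in_fball[n nk wn]|].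
  have [x xn xw] := iso_path_lift (leq_trans nk kr) wn; exists x => //=.
  by apply/in_fball; exists n.
move=> [x /in_fball xk ->]; apply/in_fball/iso_gball => //; exact: gball_le xk.
Qed.

End ball_isomorphism.

(** The radius [r + 1] is needed to see all the moves from the vertices of the
    ball of radius [r]. *)
Lemma ball_sum_iso (R : realType) (r n : nat) (g : R -> nat -> nat -> R)
    (G H : rgraph) :
  (n <= r)%N -> rball_iso r.+1 G H -> ball_sum r n g G = ball_sum r n g H.
Proof.
move=> nr [f [f_root f_bij f_adj]]; rewrite /ball_sum.
rewrite (iso_fball f_root f_bij f_adj (leqnSn r)) big_imfset /=; last first.
  move=> x y /in_fball xr /in_fball yr; have [_ inj _] := f_bij.
  by apply: inj; apply/mem_set; exact: gball_le (leqnSn r) _ _.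
rewrite !big_seq; apply: eq_bigr => x /in_fball xr.
have xr1 := gball_le (leqnSn r) xr.
rewrite (iso_hops f_root f_bij f_adj)//.
rewrite (iso_card_moves f_root f_bij f_adj (ltnSn r))// -f_root.
have nr1 : (0 + n <= r.+1)%N by exact: leqW.
by rewrite (iso_walk_prob f_root f_bij f_adj R nr1)//; exact: gball_refl.
Qed.

Section local_sets.
Variable r : nat.

(** Vertices are natural numbers, so a finite ball with all edges that leave its
    vertices is an element of a countable type.  Rooted graphs with the same
    code have isomorphic balls, through the identity on labels. *)
Definition ball_code (G : rgraph) : nat * {fset nat} * {fset nat * nat} :=
  (val (root G), [fset val x | x in fball G r]%fset,
   [fset (val x, val y) | x in fball G r, y in nbrs x]%fset).

Lemma ball_code_iso (G H : rgraph) : ball_code G = ball_code H -> rball_iso r G H.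
Proof.
move=> [root_eq ball_eq edge_eq].
have label (K L : rgraph) (x : K) :
    [fset val x | x in fball K r]%fset = [fset val x | x in fball L r]%fset ->
    gball (root K) r x -> exists2 y : L, gball (root L) r y & val y = val x.
  move=> KL /in_fball xr.
  have : val x \in [fset val x | x in fball K r]%fset by exact: in_imfset.
  by rewrite KL => /imfsetP[y /= /in_fball yr ->]; exists y.
pose f (x : G) : H := insubd (root H) (val x).
have fE x : gball (root G) r x -> val (f x) = val x.
  move=> /(label _ _ _ ball_eq)[y _ yx].
  by rewrite /f /insubd -yx valK.
exists f; split.
- by apply: val_inj; rewrite fE//; exact: gball_refl.
- split.
  + move=> x /[dup] xr /(label _ _ _ ball_eq)[y yr yx].
    by rewrite (_ : f x = y)//; apply: val_inj; rewrite fE.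
  + move=> x y /set_mem xr /set_mem yr fxy.
    by apply: val_inj; rewrite -(fE _ xr) fxy fE.
  + move=> y /(label _ _ _ (esym ball_eq))[x xr xy]; exists x => //.
    by apply: val_inj; rewrite fE.
have edge (K : rgraph) (x y : K) : gball (root K) r x ->
    ((val x, val y) \in [fset (val x, val y) | x in fball K r, y in nbrs x]%fset)
    = adj K x y.
  move=> /in_fball xr; apply/imfset2P/idP => /= [[u _ [v uv [xu yv]]]|xy].
    by rewrite (val_inj xu) (val_inj yv).
  by exists x => //; exists y.
move=> x y /set_mem xr /set_mem yr.
have [x' x'r xx'] := label _ _ _ ball_eq xr.
have -> : f x = x' by apply: val_inj; rewrite fE.
by rewrite -(edge H)// xx' fE// -(edge G)// -edge_eq.
Qed.

(** Such a set is the union, over the countably many codes of its elements, of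
    one open ball of the local topology for each code. *)
Lemma measurable_local (A : set rgraph) :
  (forall G H, rball_iso r G H -> A H -> A G) -> measurable A.
Proof.
move=> Aiso.
pose F c : set rgraph :=
  if pselect (exists2 H, A H & ball_code H = c) is left e
  then [set G | rball_iso r G (projT1 (cid2 e))] else set0.
have -> : A = \bigcup_c F c.
  apply/seteqP; split => [G AG|G [c _]].
    exists (ball_code G) => //; rewrite /F; case: pselect => [e|].
      by case: cid2 => /= H _ HG; apply: ball_code_iso.
    by case; exists G.
  by rewrite /F; case: pselect => // e /=; case: cid2 => /= H AH _ /Aiso; apply.
apply: countable_bigcupT_measurable; first exact: countableP.
move=> c; rewrite /F; case: pselect => [e|_]; last exact: measurable0.
by apply: sub_sigma_algebra; exists r, (projT1 (cid2 e)).
Qed.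

End local_sets.

Lemma measurable_ball_sum (R : realType) (r n : nat) (g : R -> nat -> nat -> R) :
  (n <= r)%N -> measurable_fun [set: rgraph] (ball_sum r n g).
Proof.
move=> nr _ Y mY; rewrite setTI; apply: (@measurable_local r.+1) => G H GH.
by rewrite /preimage /= (ball_sum_iso g nr GH).
Qed.

(** * Averages over the random graph *)

Section annealed.
Context d (T : measurableType d) (R : realType) (P : probability T R).
Variable X : {RV P >-> rgraph}.
Implicit Types n r : nat.

Lemma measurable_ball_sum_RV r n (g : R -> nat -> nat -> R) : (n <= r)%N ->
  measurable_fun [set: T] (fun w => ball_sum r n g (X w)).
Proof.
by move=> nr; apply: (measurableT_comp (measurable_ball_sum g nr)).
Qed.

Lemma integrable_moment n : P.-integrable [set: T] (fun w => (moment R n (X w))%:E).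
Proof.
apply: (le_integrable measurableT _ _
  (finite_measure_integrable_cst P (n.+1%:R ^+ 2) measurableT)).
  by apply/measurable_EFinP/measurable_ball_sum_RV.
move=> w _ /=; rewrite lee_fin !ger0_norm ?moment_ge0 ?sqr_ge0//.
exact: moment_le.
Qed.

Variables (c e : R).
Hypothesis c_gt0 : 0 < c.
Hypothesis growth : forall r, (1 <= r)%N ->
  (\int[P]_w counting (gball (root (X w)) r) <= (c * r%:R `^ e)%:E)%E.

Lemma integrable_volume r : (1 <= r)%N ->
  P.-integrable [set: T] (fun w => (volume R r (X w))%:E).
Proof.
move=> r1; apply/integrableP; split.
  by apply/measurable_EFinP/measurable_ball_sum_RV.
under eq_integral do rewrite gee0_abs ?lee_fin ?volume_ge0// volumeE.
exact: le_lt_trans (growth r1) (ltry _).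
Qed.

Lemma Rintegral_volume r : (1 <= r)%N ->
  \int[P]_w volume R r (X w) <= c * r%:R `^ e.
Proof.
move=> r1; rewrite -lee_fin /Rintegral fineK.
  by under eq_integral do rewrite volumeE; exact: growth.
by apply: integrable_fin_num => //; exact: integrable_volume.
Qed.

Lemma integrable_entropy n : P.-integrable [set: T] (fun w => (entropy R n (X w))%:E).
Proof.
apply: (le_integrable measurableT _ _
  (integrableZl measurableT 2 (integrable_volume (ltn0Sn n)))).
  by apply/measurable_EFinP/measurable_ball_sum_RV.
move=> w _; rewrite -EFinM /= lee_fin !ger0_norm ?entropy_ge0//; last first.
  by rewrite mulr_ge0 ?volume_ge0.
have := entropy_le n (X w) (@ltr01 R).
by rewrite ln1 mulr0 add0r divr1.
Qed.

(** [entropy_le] with [b] equal to the bound on the mean volume of the ball. *)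
Lemma Rintegral_entropy n :
  \int[P]_w entropy R n (X w) <= (2 * ln c + 2) + 2 * e * ln n.+1%:R.
Proof.
pose b := c * n.+1%:R `^ e.
have b0 : 0 < b by rewrite mulr_gt0// powR_gt0.
have iV : P.-integrable [set: T] (EFin \o (fun w => volume R n.+1 (X w))).
  exact: integrable_volume.
have iVb : P.-integrable [set: T]
    (EFin \o (fun w => 2 / b * volume R n.+1 (X w))).
  exact: (integrableZl measurableT (2 / b) iV).
have ic k : P.-integrable [set: T] (EFin \o cst k).
  exact: finite_measure_integrable_cst.
apply: (@le_trans _ _ (\int[P]_w (2 * ln b + 2 / b * volume R n.+1 (X w)))).
  apply: le_Rintegral => //; first exact: integrable_entropy.
    exact: (integrableD measurableT (ic (2 * ln b)) iVb).
  move=> w _; apply: le_trans (entropy_le n (X w) b0) _.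
  by rewrite lerD2l -mulrA (mulrC b^-1).
rewrite (RintegralD measurableT (ic (2 * ln b)) iVb).
rewrite (RintegralZl (2 / b) measurableT iV) Rintegral_cst//.
have -> : fine (P [set: T]) = 1 by rewrite (@probability_setT _ _ _ P).
rewrite mulr1 /b lnM ?posrE ?powR_gt0// ln_powR.
have : 2 / b * \int[P]_w volume R n.+1 (X w) <= 2.
  rewrite mulrAC ler_pdivrMr// ler_pM2l//; exact: Rintegral_volume.
rewrite -/b; lra.
Qed.

Lemma Rintegral_moment_step n (dl : R) : 0 < dl ->
  \int[P]_w moment R n.+2 (X w) <=
  \int[P]_w moment R n (X w) + 4 * dl * \int[P]_w moment R n.+1 (X w)
  + 9 / (4 * dl) * (\int[P]_w entropy R n.+1 (X w) - \int[P]_w entropy R n (X w)).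
Proof.
move=> dl0.
have iM k := integrable_moment k; have iS k := integrable_entropy k.
have iM1 : P.-integrable [set: T]
    (EFin \o (fun w => 4 * dl * moment R n.+1 (X w))).
  exact: (integrableZl measurableT _ (iM n.+1)).
have iSS : P.-integrable [set: T]
    (EFin \o (fun w => entropy R n.+1 (X w) - entropy R n (X w))).
  exact: (integrableB measurableT (iS n.+1) (iS n)).
have iS1 : P.-integrable [set: T]
    (EFin \o (fun w => 9 / (4 * dl) * (entropy R n.+1 (X w) - entropy R n (X w)))).
  exact: (integrableZl measurableT _ iSS).
have iMM : P.-integrable [set: T]
    (EFin \o (fun w => moment R n (X w) + 4 * dl * moment R n.+1 (X w))).
  exact: (integrableD measurableT (iM n) iM1).
rewrite -(RintegralB measurableT (iS n.+1) (iS n)).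
rewrite -(RintegralZl _ measurableT iSS) -(RintegralZl _ measurableT (iM n.+1)).
rewrite -(RintegralD measurableT (iM n) iM1) -(RintegralD measurableT iMM iS1).
apply: le_Rintegral => //; first exact: iM.
  exact: (integrableD measurableT iMM iS1).
by move=> w _; exact: moment_step.
Qed.

End annealed.

Lemma markov_sq_disp d (T : measurableType d) (R : realType)
    (P : probability T R) (X : {RV P >-> rgraph}) n (a eps : R) :
    0 < a -> \int[P]_w moment R n (X w) <= eps * a ->
  ((1 - eps)%:E <= P [set w | (sq_disp R n (X w) <= a)%R])%E.
Proof.
move=> a0 ma; set A := [set w | _].
have mA : measurable A.
  have := @measurable_ball_sum_RV d T R P X n n
    (fun p _ d => p * d%:R ^+ 2) (leqnn n).
  by move=> /(_ measurableT _ (measurable_itv `]-oo, a])); rewrite setTI;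
     congr measurable; apply/seteqP; split=> w; rewrite /= in_itv.
have le_eps : (P (~` A) <= eps%:E)%E.
  have : (a%:E * P (~` A) <= a%:E * eps%:E)%E.
    rewrite -integral_cst; last exact: measurableC.
    apply: (@le_trans _ _ (\int[P]_(w in ~` A) (moment R n (X w))%:E)%E).
      apply: ge0_le_integral => //.
      - exact: measurableC.
      - by move=> w _; rewrite lee_fin ltW.
      - apply/measurable_EFinP; apply: measurable_funTS.
        exact: measurable_ball_sum_RV.
      - move=> w /negP; rewrite -ltNge lee_fin => /ltW /le_trans; apply.
        exact: sq_disp_le_moment.
    apply: (@le_trans _ _ (\int[P]_w (moment R n (X w))%:E)%E).
      apply: ge0_subset_integral => //; first exact: measurableC.
        by apply/measurable_EFinP/measurable_ball_sum_RV.
      by move=> w _; rewrite lee_fin moment_ge0.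
    rewrite -(@fineK _ (\int[P]_w _)%E); last first.
      by apply: integrable_fin_num => //; exact: integrable_moment.
    by rewrite -EFinM lee_fin mulrC.
  by rewrite lee_pmul2l.
have := probability_setC P (measurableC mA); rewrite setCK => ->.
by rewrite EFinB leeB.
Qed.

Theorem theorem1p4 (d : measure_display) (T : measurableType d) (R : realType)
    (P : probability T R) (X : {RV P >-> rgraph})
    (Xconn : {ae P, forall w, connected_graph (X w)})
    (Xstat : stationary X)
    (Xgrowth : annealed_polynomial_growth X) :
  forall eps : R, 0 < eps ->
  exists C : R, 0 < C /\
  exists t : nat -> nat,
    [/\ forall n, (0 < t n)%N,
        {homo t : m n / (m < n)%N} &
        forall n, ((1 - eps)%:E <=
          P [set w | (walk_expect (t n)
                        (fun y : X w => (gdist R (root (X w)) y ^+ 2)%E)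
                      <= (C * (t n)%:R)%:E)%E])%E].
Proof.
move=> eps eps0; have [c [e [c0 e0 growth]]] := Xgrowth.
have [K K0 KP] := @linear_bound_infinitely_often R
  (fun n => \int[P]_w moment R n (X w)) (fun n => \int[P]_w entropy R n (X w))
  (2 * ln c + 2) (2 * e)
  (fun n => Rintegral_ge0 P (fun w _ => moment_ge0 R n (X w)))
  (mulr_ge0 (ler0n R 2) (ltW e0))
  (fun n => Rintegral_entropy c0 growth n)
  (fun n dl dl0 => Rintegral_moment_step growth n dl0).
have [g gP] := choice KP.
pose t := fix t n := if n is m.+1 then g (t m).+1 else g 0%N.
have tP n : (0 < t n)%N /\ \int[P]_w moment R (t n) (X w) <= K * (t n)%:R.
  by case: n => [|n] /=; [have [] := gP 0%N|have [] := gP (t n).+1].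
exists (K / eps); split; first exact: divr_gt0.
exists t; split.
- by move=> n; have [] := tP n.
- apply: homo_ltn; first by move=> y x z; exact: ltn_trans.
  by move=> n; have [] := gP (t n).+1.
- move=> n; have [tn0 tnK] := tP n.
  have Kt0 : 0 < K / eps * (t n)%:R by rewrite mulr_gt0 ?divr_gt0 ?ltr0n.
  have -> : [set w | (walk_expect (t n)
      (fun y : X w => (gdist R (root (X w)) y ^+ 2)%E) <= (K / eps * (t n)%:R)%:E)%E]
      = [set w | sq_disp R (t n) (X w) <= K / eps * (t n)%:R].
    by apply/seteqP; split=> w /=; rewrite walk_expect_gdist lee_fin.
  apply: markov_sq_disp Kt0 _; apply: le_trans tnK _.
  by rewrite mulrA (mulrCA eps) divff ?mulr1// gt_eqF.
Qed.
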